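(* Let $a<b$ be real numbers, let $m>0$ be real and let $\sigma\in\mathcal{A}(m)$. Let $f_0:[a,b]\to(\mathbb{E}^1,D_S)$ be continuous, where $D_S$ is the sendograph metric. Then, for every $n\in\mathbb{N}$, $n\geq 1$, $$\sup_{x\in[a,b]} D_S\big(S_{n,\sigma}(f_0,x), f_0(x)\big)\leq\sqrt{2}\cdot\omega^{\mathcal{F}}_{D_S}\Big(f_0,\frac{b-a}{n}\Big).$$
   Context: Fuzzy numbers: for $u:\mathbb{R}\to[0,1]$ put $[u]^{\lambda}=\{x\in\mathbb{R}: u(x)\ge\lambda\}$ for $\lambda\in(0,1]$ and $[u]^0=\overline{\{x\in\mathbb{R}: u(x)>0\}}$. A fuzzy number is a function $u:\mathbb{R}\to[0,1]$ such that: there is $x$ with $u(x)=1$; $u$ is upper semicontinuous; $u(\alpha x+(1-\alpha)y)\ge\min\{u(x),u(y)\}$ for all $x,y\in\mathbb{R}$, $\alpha\in[0,1]$; and $[u]^0$ is compact. $\mathbb{E}^1$ is the set of fuzzy numbers. Arithmetic: for $u,v\in\mathbb{E}^1$ and $c\in\mathbb{R}$, $u+v$ and $cu$ are the fuzzy numbers determined levelwise by $[u+v]^\lambda=[u]^\lambda+[v]^\lambda$ (Minkowski sum) and $[cu]^\lambda=c[u]^\lambda$, $\lambda\in[0,1]$. Class $\mathcal{A}(m)$: for real $m>0$, $\sigma\in\mathcal{A}(m)$ means $\sigma:\mathbb{R}\to\mathbb{R}$ is nondecreasing with $\sigma(x)=0$ for $x\le -m$ and $\sigma(x)=1$ for $x\ge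 m$. Put $\varphi(x)=\sigma(x+m)-\sigma(x-m)$. Operator: for $f:[a,b]\to\mathbb{E}^1$, $x\in[a,b]$ and $n\ge1$, $$S_{n,\sigma}(f,x)=\sum_{k=0}^{n}\varphi\Big(\frac{2m}{h}(x-x_k)\Big)f(x_k),\qquad h=\frac{b-a}{n},\quad x_k=a+kh.$$ Sendograph metric: $\mathrm{send}(u)=\{(x,\alpha)\in[u]^0\times[0,1]: u(x)\ge\alpha\}$, a compact set, and $D_S(u,v)=d_H(\mathrm{send}(u),\mathrm{send}(v))$, where $d_H$ is the Hausdorff distance in $\mathbb{R}\times[0,1]$ with the Euclidean metric. Fuzzy modulus of continuity: $\omega^{\mathcal{F}}_{D_S}(f,\delta)=\sup\{D_S(f(x),f(y)): x,y\in[a,b],\ |x-y|<\delta\}$. *)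

(* Defs.v *)
From HB Require Import structures.
From mathcomp Require Import all_boot all_order all_algebra.
From mathcomp Require Import all_classical all_reals all_analysis.
From mathcomp Require Import ring.

Set Implicit Arguments.
Unset Strict Implicit.
Unset Printing Implicit Defensive.

Import Order.TTheory GRing.Theory Num.Theory.
Import numFieldNormedType.Exports.

Local Open Scope classical_set_scope.
Local Open Scope ring_scope.

(* The library only has [lower_semicontinuous], for \bar R-valued functions. *)
Definition upper_semicontinuous {T : topologicalType} {R : realType}
    (u : T -> R) :=
  forall x e, u x < e -> \forall y \near x, u y < e.

Definition fun_level {R : realType} (u : R -> R) (l : R) : set R :=
  if 0 < l then [set x | l <= u x] else closure [set x | 0 < u x].

Definition is_fuzzy_number {R : realType} (u : R -> R) : Prop :=
  [/\ forall x, 0 <= u x <= 1,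
      exists x, u x = 1,
      upper_semicontinuous u,
      forall x y t, 0 <= t <= 1 ->
        Num.min (u x) (u y) <= u (t * x + (1 - t) * y)
    & compact (fun_level u 0)].

Record fuzzy_number (R : realType) := FuzzyNumber {
  membership :> R -> R ;
  membershipP : is_fuzzy_number membership }.

HB.instance Definition _ (R : realType) := gen_eqMixin (fuzzy_number R).
HB.instance Definition _ (R : realType) := gen_choiceMixin (fuzzy_number R).

Definition level {R : realType} (u : fuzzy_number R) (l : R) : set R :=
  fun_level u l.

Section fuzzy_number_theory.
Variable R : realType.
Implicit Types u v w : fuzzy_number R.

Lemma fuzzy_ge0 u x : 0 <= u x.
Proof. by have [/(_ x)/andP[]] := membershipP u. Qed.

Lemma fuzzy_le1 u x : u x <= 1.
Proof. by have [/(_ x)/andP[]] := membershipP u. Qed.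

Lemma level_gt0 u l : 0 < l -> level u l = [set x | l <= u x].
Proof. by rewrite /level /fun_level => ->. Qed.

Lemma level_0 u : level u 0 = closure [set x | 0 < u x].
Proof. by rewrite /level /fun_level ltxx. Qed.

Lemma level_neq0 u l : 0 <= l <= 1 -> level u l !=set0.
Proof.
case: u => u [u01 [x ux] usc uc ucpt] /andP[l0 l1]; exists x.
rewrite /level /fun_level; case: ifPn => [_|_] /=; first by rewrite ux.
by apply: subset_closure => /=; rewrite ux.
Qed.

Lemma level_inj u v :
  (forall l, 0 <= l <= 1 -> level u l = level v l) -> u = v.
Proof.
have le u' v' : (forall l, 0 <= l <= 1 -> level u' l = level v' l) ->
    forall x, u' x <= v' x.
  move=> uv x; have [u0|u0] := leP (u' x) 0.
    by rewrite (le_trans u0)// fuzzy_ge0.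
  have : level u' (u' x) x by rewrite level_gt0/=.
  by rewrite uv ?level_gt0//= (ltW u0) fuzzy_le1.
move=> uv; have E : membership u = membership v.
  apply/funext => x; apply/eqP; rewrite eq_le !le// => l l01.
  by rewrite uv.
case: u v E {uv} => u pu [v pv] /= E; rewrite -E in pv *.
by congr FuzzyNumber; exact: Prop_irrelevance.
Qed.

Section lincomb.
Variables (c d : R) (u v : fuzzy_number R).

Let g (p : R * R) : R := c * p.1 + d * p.2.
Let w (p : R * R) : R := Num.min (u p.1) (v p.2).
Let K : set (R * R) := level u 0 `*` level v 0.

Let g_cont : continuous g.
Proof.
move=> p; apply: cvgD; apply: cvgM; try exact: cvg_cst.
- exact: cvg_fst.
- exact: cvg_snd.
Qed.

Let K_compact : compact K.
Proof. by apply: compact_setX; [case: u | case: v] => ? []. Qed.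

Let w_ge0 p : 0 <= w p.
Proof. by rewrite /w le_min !fuzzy_ge0. Qed.

Let w_le1 p : w p <= 1.
Proof. by rewrite /w ge_min fuzzy_le1. Qed.

Let w_K p : 0 < w p -> K p.
Proof.
rewrite /w lt_min => /andP[u0 v0]; split; rewrite level_0; exact: subset_closure.
Qed.

Let w_closed l : closed [set p | l <= w p].
Proof.
rewrite -openC => //; rewrite openE => p /= /negP; rewrite -ltNge => wl.
have [_ _ uscu _ _] := membershipP u; have [_ _ uscv _ _] := membershipP v.
move: wl; rewrite /w gt_min => /orP[/uscu ul|/uscv vl].
- have /cvg_fst := ul => H.
  near=> q; apply/negP; rewrite -ltNge gt_min; apply/orP; left.
  by near: q; exact: H.
- have /cvg_snd := vl => H.
  near=> q; apply/negP; rewrite -ltNge gt_min; apply/orP; right.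
  by near: q; exact: H.
Unshelve. all: by end_near. Qed.

Let z (x : R) : R := sup (0 |` (w @` (g @^-1` [set x]))).

Let z_has_sup x : has_sup (0 |` (w @` (g @^-1` [set x]))).
Proof.
split; first by exists 0; left.
by exists 1 => r [->|[p _ <-]].
Qed.

Let z_ub p : w p <= z (g p).
Proof. by apply: ub_le_sup; [case: (z_has_sup (g p)) | right; exists p]. Qed.

Let z_ge0 x : 0 <= z x.
Proof. by apply: ub_le_sup; [case: (z_has_sup x) | left]. Qed.

Let z_le1 x : z x <= 1.
Proof.
by apply: ge_sup => [|r [->//|[p _ <-//]]]; case: (z_has_sup x).
Qed.

Let z_level l : 0 < l -> [set x | l <= z x] = g @` [set p | l <= w p].
Proof.
move=> l0; apply/seteqP; split=> x /=; last first.
  by move=> [p lp <-]; exact: le_trans (z_ub p).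
move=> lz.
pose D r := [set p | g p = x /\ r <= w p].
have D0 r : 0 < r < l -> D r !=set0.
  move=> /andP[r0 rl].
  have [|s [s0|[p gp <-]]] := @sup_adherent _ _ (z x - r) _ (z_has_sup x).
  - by rewrite subr_gt0 (lt_le_trans rl).
  - by rewrite s0 subKr => /(lt_trans r0); rewrite ltxx.
  - by rewrite subKr => /ltW rp; exists p.
pose F : set_system (R * R) := filter_from [set r | 0 < r < l] D.
have FF : ProperFilter F.
  apply: filter_from_proper; last by move=> r /D0.
  apply: filter_from_filter.
    by exists (l / 2); rewrite /= divr_gt0//= ltr_pdivrMr// ltr_pMr// ltr1n.
  move=> r s r0l s0l; exists (Num.max r s).
    move: r0l s0l => /= /andP[r0 rl] /andP[s0 sl].
    by rewrite lt_max r0/= gt_max rl sl.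
  by move=> p [gp]; rewrite ge_max => /andP[rp sp].
have FK : F K.
  exists (l / 2).
    by rewrite /= divr_gt0//= ltr_pdivrMr// ltr_pMr// ltr1n.
  move=> p [_ lp]; apply: w_K; apply: lt_le_trans lp; exact: divr_gt0.
have [p [_ pF]] := K_compact FF FK.
have cl_ r A : 0 < r < l -> closed A -> D r `<=` A -> A p.
  move=> rl cA DA; rewrite (closure_id A).1// => B pB.
  by apply: pF => //; exists r.
exists p; last first.
  apply: (cl_ (l / 2) (g @^-1` [set x])).
  - by rewrite divr_gt0//= ltr_pdivrMr// ltr_pMr// ltr1n.
  - by apply: closed_comp => // ? _; exact: g_cont.
  - by move=> q [].
rewrite leNgt; apply/negP => wl.
have ml : 0 < (w p + l) / 2 < l.
  apply/andP; split; last exact: (midf_lt wl).2.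
  by rewrite divr_gt0// ltr_wpDl.
have : (w p + l) / 2 <= w p.
  apply: (cl_ _ [set q | (w p + l) / 2 <= w q] ml) => //.
  by move=> q [].
by rewrite leNgt (midf_lt wl).1.
Qed.

Let z_level0 : closure [set x | 0 < z x] = g @` K.
Proof.
have gKc : compact (g @` K).
  by apply: continuous_compact => //; exact: continuous_subspaceT.
apply/seteqP; split.
  rewrite [X in _ `<=` X](closure_id _).1; last first.
    by apply: compact_closed gKc; exact: Rhausdorff.
  apply: closureS => x /= x0.
  have : [set y | z x <= z y] x by rewrite /=.
  rewrite z_level// => -[p /= zp <-]; exists p => //.
  by apply: w_K; exact: lt_le_trans zp.
move=> r [[x y] [xu yv] <-] B Bz; move: xu yv; rewrite /= !level_0 => xu yv.
have [[P Q] [/= xP yQ] PQ] : nbhs (x, y) (g @^-1` B) by exact: g_cont.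
have [x' [ux' Px']] := xu _ xP; have [y' [vy' Qy']] := yv _ yQ.
exists (g (x', y')); split; last exact: (PQ (x', y')).
by apply: lt_le_trans (z_ub _); rewrite /w lt_min; apply/andP.
Qed.

Let z_fuzzy : is_fuzzy_number z.
Proof.
split.
- by move=> x; rewrite z_ge0 z_le1.
- have [_ [x ux] _ _ _] := membershipP u; have [_ [y vy] _ _ _] := membershipP v.
  exists (g (x, y)); apply/eqP; rewrite eq_le z_le1/=.
  by apply: le_trans (z_ub _); rewrite /w /= ux vy minxx.
- move=> x e ze.
  have e0 : 0 < e by exact: le_lt_trans ze.
  have : open (~` [set x | e <= z x]).
    rewrite openC z_level//; apply: compact_closed; first exact: Rhausdorff.
    apply: continuous_compact; first exact: continuous_subspaceT.
    apply: (subclosed_compact _ K_compact) => // p /= ep.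
    by apply: w_K; exact: lt_le_trans ep.
  have -> : (~` [set y | e <= z y]) = [set y | z y < e].
    by apply/seteqP; split => y /=; rewrite ltNge => /negP.
  by move=> ze_open; exact: (open_nbhs_nbhs (conj ze_open ze)).
- move=> x y t t01.
  have [m0|m0] := leP (Num.min (z x) (z y)) 0; first exact: le_trans (z_ge0 _).
  set m := Num.min (z x) (z y) in m0 *.
  have : [set a | m <= z a] x by rewrite /= /m ge_min lexx.
  have : [set a | m <= z a] y by rewrite /= /m ge_min lexx orbT.
  rewrite z_level// => -[q /= mq <-] [p /= mp <-].
  have -> : t * g p + (1 - t) * g q =
      g (t * p.1 + (1 - t) * q.1, t * p.2 + (1 - t) * q.2).
    by rewrite /g /=; ring.
  apply: le_trans (z_ub _); rewrite /w /=.
  have [_ _ _ uc _] := membershipP u; have [_ _ _ vc _] := membershipP v.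
  move: mp mq; rewrite /w !le_min => /andP[mp1 mp2] /andP[mq1 mq2].
  apply/andP; split; [apply: le_trans (uc _ _ _ t01) | apply: le_trans (vc _ _ _ t01)];
    by rewrite le_min; apply/andP.
- rewrite /fun_level ltxx z_level0; apply: continuous_compact => //.
  exact: continuous_subspaceT.
Qed.

Lemma fuzzy_lincomb_ex : exists r : fuzzy_number R, forall l, 0 <= l <= 1 ->
  level r l = [set c * x + d * y | x in level u l & y in level v l].
Proof.
exists (FuzzyNumber z_fuzzy) => l /andP[+ l1]; rewrite le_eqVlt => /predU1P[<-|l0].
  rewrite level_0 z_level0; apply/seteqP; split => x.
    by move=> [[a b] [Ka Kb] <-]; exists a => //; exists b.
  by move=> [a ua [b vb <-]]; exists (a, b).
rewrite !level_gt0// [LHS]z_level//; apply/seteqP; split => x.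
  move=> [[a b]]; rewrite /w /= le_min => /andP[la lb] <-.
  by exists a => //; exists b.
move=> [a ua [b vb <-]]; exists (a, b) => //=.
by rewrite /w le_min; apply/andP.
Qed.

End lincomb.

Lemma fuzzy_add_ex u v : exists w, forall l, 0 <= l <= 1 ->
  level w l = [set x + y | x in level u l & y in level v l].
Proof.
have [w wE] := fuzzy_lincomb_ex 1 1 u v; exists w => l /wE ->.
by apply/seteqP; split => _ [x ux [y vy <-]]; exists x => //; exists y => //;
  rewrite !mul1r.
Qed.

Lemma fuzzy_scale_ex (c : R) u : exists w, forall l, 0 <= l <= 1 ->
  level w l = [set c * x | x in level u l].
Proof.
have [w wE] := fuzzy_lincomb_ex c 0 u u; exists w => l l01; rewrite wE//.
apply/seteqP; split => [_ [x ux [y vy <-]]|_ [x ux <-]].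
  by exists x => //; rewrite mul0r addr0.
by exists x => //; exists x => //; rewrite mul0r addr0.
Qed.

Definition fuzzy_add u v : fuzzy_number R := sval (cid (fuzzy_add_ex u v)).

Definition fuzzy_scale (c : R) u : fuzzy_number R :=
  sval (cid (fuzzy_scale_ex c u)).

Lemma level_fuzzy_add u v l : 0 <= l <= 1 ->
  level (fuzzy_add u v) l = [set x + y | x in level u l & y in level v l].
Proof. by rewrite /fuzzy_add; case: cid => w /= + /[dup] _; apply. Qed.

Lemma level_fuzzy_scale c u l : 0 <= l <= 1 ->
  level (fuzzy_scale c u) l = [set c * x | x in level u l].
Proof. by rewrite /fuzzy_scale; case: cid => w /= + /[dup] _; apply. Qed.

Lemma crisp0_fuzzy : is_fuzzy_number (fun x : R => if x == 0 then 1 else 0).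
Proof.
have h0 : [set x : R | (0 : R) < (if x == 0 then 1 else 0)] = [set 0].
  by apply/seteqP; split => x /=; case: eqP => [->|]//; rewrite ?ltxx ?ltr01.
split.
- by move=> x; case: ifP; rewrite ?lexx ?ler01.
- by exists 0; rewrite eqxx.
- move=> x e; have [->|x0 e0] := eqVneq x 0 => [e1|].
    by near=> y; case: ifP => // _; exact: lt_trans e1.
  have : \forall y \near x, y != 0.
    by apply: (@open_nbhs_nbhs _ x [set y | y != 0]); split => //; exact: open_neq.
  by apply: filterS => y /negPf ->.
- move=> x y t /andP[t0 t1].
  have [->|_] := eqVneq x 0; last by rewrite ge_min; case: ifP; rewrite ?ler01 ?lexx.
  have [->|_] := eqVneq y 0; first by rewrite !mulr0 addr0 eqxx minxx.
  by rewrite ge_min; case: ifP; rewrite ?ler01 ?lexx ?orbT.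
- rewrite /fun_level ltxx h0 -(closure_id _).1; first exact: compact_set1.
  exact: closed_eq.
Unshelve. all: by end_near. Qed.

Definition fuzzy_zero : fuzzy_number R := FuzzyNumber crisp0_fuzzy.

Lemma level_fuzzy_zero l : 0 <= l <= 1 -> level fuzzy_zero l = [set 0].
Proof.
have h (r : R) : 0 < r <= 1 ->
    [set x : R | r <= (if x == 0 then 1 else 0)] = [set 0].
  move=> /andP[r0 r1]; apply/seteqP; split => x /=; case: eqP => [->|]//.
  by rewrite leNgt r0.
move=> /andP[+ l1]; rewrite le_eqVlt => /predU1P[<-|l0]; last first.
  by rewrite level_gt0//= h// l0.
rewrite level_0 (_ : [set x | _] = [set 0]); first exact/esym/(closure_id _).1/closed_eq.
by apply/seteqP; split => x /=; case: eqP => [->|]//; rewrite ?ltxx ?ltr01.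
Qed.

Lemma fuzzy_addC : commutative fuzzy_add.
Proof.
move=> u v; apply: level_inj => l l01; rewrite !level_fuzzy_add//.
by apply/seteqP; split => _ [x ux [y vy <-]]; exists y => //; exists x => //;
  rewrite addrC.
Qed.

Lemma fuzzy_addA : associative fuzzy_add.
Proof.
move=> u v w; apply: level_inj => l l01; rewrite !level_fuzzy_add//.
apply/seteqP; split.
  move=> _ [x ux [_ [y vy [s ws <-]] <-]].
  by exists (x + y); [exists x => //; exists y | exists s; rewrite ?addrA].
move=> _ [_ [x ux [y vy <-]] [s ws <-]].
by exists x => //; exists (y + s); [exists y => //; exists s | rewrite addrA].
Qed.

Lemma fuzzy_add0 : left_id fuzzy_zero fuzzy_add.
Proof.
move=> u; apply: level_inj => l l01.
rewrite level_fuzzy_add// level_fuzzy_zero//.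
apply/seteqP; split => [_ [_ -> [y uy <-]]|x ux]; first by rewrite add0r.
by exists 0 => //; exists x => //; rewrite add0r.
Qed.

HB.instance Definition _ :=
  GRing.isNmodule.Build (fuzzy_number R) fuzzy_addA fuzzy_addC fuzzy_add0.

End fuzzy_number_theory.

Definition class_A {R : realType} (m : R) (sigma : R -> R) : Prop :=
  [/\ {homo sigma : x y / x <= y},
      forall x, x <= - m -> sigma x = 0
    & forall x, m <= x -> sigma x = 1].

Definition sigma_bump {R : realType} (m : R) (sigma : R -> R) (x : R) : R :=
  sigma (x + m) - sigma (x - m).

(* Only the values of [f] at the nodes, which lie in [a, b], are used. *)
Definition fuzzy_operator {R : realType} (a b m : R) (sigma : R -> R) (n : nat)
    (f : R -> fuzzy_number R) (x : R) : fuzzy_number R :=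
  let h := (b - a) / n%:R in
  let node (k : nat) := a + k%:R * h in
  \sum_(k < n.+1)
    fuzzy_scale (sigma_bump m sigma (2 * m / h * (x - node k))) (f (node k)).

(* The norm that the library puts on R * R is the sup norm. *)
Definition euclidean_dist {R : realType} (p q : R * R) : R :=
  Num.sqrt ((p.1 - q.1) ^+ 2 + (p.2 - q.2) ^+ 2).

Definition hausdorff_dist {R : realType} (A B : set (R * R)) : \bar R :=
  let excess X Y := ereal_sup
    [set ereal_inf [set (euclidean_dist p q)%:E | q in Y] | p in X] in
  Order.max (excess A B) (excess B A).

Definition sendograph {R : realType} (u : fuzzy_number R) : set (R * R) :=
  [set p | [/\ level u 0 p.1, 0 <= p.2 <= 1 & p.2 <= u p.1]].

(* Extended-real valued, so that no boundedness side condition is attached to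
   the suprema; sendographs are compact and nonempty, so D_S is finite. *)
Definition D_S {R : realType} (u v : fuzzy_number R) : \bar R :=
  hausdorff_dist (sendograph u) (sendograph v).

Definition D_S_continuous {R : realType} (a b : R) (f : R -> fuzzy_number R) :=
  forall x, x \in `[a, b] -> forall e : R, 0 < e ->
    \forall y \near within [set` `[a, b]] (nbhs x), (D_S (f y) (f x) < e%:E)%E.

Definition fuzzy_modulus {R : realType} (a b : R) (f : R -> fuzzy_number R)
    (delta : R) : \bar R :=
  ereal_sup [set D_S (f p.1) (f p.2) | p in
    [set p : R * R | [/\ p.1 \in `[a, b], p.2 \in `[a, b]
                       & `|p.1 - p.2| < delta]]].

(* Main.v *)
Require Import Defs.
From mathcomp Require Import all_boot all_order all_algebra.
From mathcomp Require Import all_classical all_reals all_analysis.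
From mathcomp Require Import ring lra.

(** A different choice of metric makes the estimate almost formal.  If the
    plane carried the sup norm instead of the Euclidean one, two fuzzy numbers
    u, w would be at sendograph distance at most r exactly when, for all l,
    every point of [u]^l is within r of the level [w]^(max (l - r) 0), and
    symmetrically ([sendograph_close]).  This condition speaks of one level at
    a time, so it is compatible with the levelwise arithmetic: if every u_k
    carrying a nonzero weight is r-close to w, then so is the convex
    combination of the u_k, because the levels of w are intervals
    ([sendograph_close_convex]).  The Euclidean norm lies between the sup norm
    and sqrt 2 times the sup norm; passing to the sup norm
    ([sendograph_close_of_D_S]) is free, and coming back ([D_S_le_of_close])
    costs the factor sqrt 2 of the theorem.

    It remains to see that the operator takes convex combinations of values of
    f at nodes near x.  The weights are nonnegative since sigma is
    nondecreasing, their sum telescopes to 1 because consecutive nodes shift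
    the argument of the bump by exactly 2m ([sum_sigma_bump]), and a nonzero
    weight forces the node to be at distance strictly less than h from x,
    since the bump vanishes outside ]-2m, 2m[ ([sigma_bump_eq0]).  Hence every
    f(x_k) that matters is within the modulus of continuity of f(x). *)

Import Order.TTheory GRing.Theory Num.Theory.

Local Open Scope classical_set_scope.
Local Open Scope ring_scope.

(** * Convex combinations *)

Section convex_combination.
Variable R : realType.
Implicit Types (c x : nat -> R) (n : nat) (r : R).

Lemma is_interval_convex_sum (I : set R) n c x : is_interval I ->
  (forall k, (k < n)%N -> 0 <= c k) -> \sum_(k < n) c k = 1 ->
  (forall k, I (x k)) -> I (\sum_(k < n) c k * x k).
Proof.
case: n => [|n] II c0 c1 Ix.
  by move: c1; rewrite big_ord0 => /eqP; rewrite eq_sym oner_eq0.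
(* the combination lies between the smallest and the largest x k *)
have [i _ imin] := @arg_minP _ _ _ (@ord0 n) xpredT (fun k => x k) isT.
have [j _ jmax] := @arg_maxP _ _ _ (@ord0 n) xpredT (fun k => x k) isT.
apply: (II (x i) (x j)) => //.
rewrite -[x i]mul1r -[x j]mul1r -c1 !mulr_suml; apply/andP; split.
  by apply: ler_sum => k _; apply: ler_wpM2l; [exact: c0|exact: imin].
by apply: ler_sum => k _; apply: ler_wpM2l; [exact: c0|exact: jmax].
Qed.

(** The form in which convex combinations are compared below: approximating
    each x k that carries a nonzero weight by a point of A k, and picking any
    point of A k for the others, approximates the combination equally well. *)
Lemma convex_sum_approx n c x r (A : nat -> set R) :
  (forall k, (k < n)%N -> 0 <= c k) -> \sum_(k < n) c k = 1 ->
  (forall k, A k !=set0) ->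
  (forall k, (k < n)%N -> c k != 0 -> exists2 y, A k y & `|x k - y| <= r) ->
  exists2 y : nat -> R, (forall k, A k (y k)) &
    `|\sum_(k < n) c k * x k - \sum_(k < n) c k * y k| <= r.
Proof.
move=> c0 c1 A0 xA.
have /choice[y Ay] : forall k, exists y, A k y /\
    ((k < n)%N -> c k != 0 -> `|x k - y| <= r).
  move=> k; have [/andP[kn ck]|/negP H] := boolP ((k < n)%N && (c k != 0)).
    by have [y ? ?] := xA _ kn ck; exists y.
  have [y Ay] := A0 k; exists y; split=> // kn ck.
  by exfalso; apply: H; rewrite kn.
exists y => [k|]; first by case: (Ay k).
rewrite -sumrB (le_trans (ler_norm_sum _ _ _))//.
rewrite -[r]mul1r -c1 mulr_suml; apply: ler_sum => k _.
rewrite -mulrBr normrM ger0_norm ?c0//.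
have [->|ck] := eqVneq (c k) 0; first by rewrite !mul0r.
by rewrite ler_wpM2l ?c0//; apply: (Ay k).2.
Qed.

End convex_combination.

(** * Levels of fuzzy numbers *)

Section levels.
Variable R : realType.
Implicit Types (u v w : fuzzy_number R) (l r x : R).

Lemma level_antitone u l l' : 0 <= l <= l' -> level u l' `<=` level u l.
Proof.
move=> /andP[+ ll']; rewrite le_eqVlt => /predU1P[l0|l0]; last first.
  rewrite !level_gt0 ?(lt_le_trans l0)// => x /=; exact: le_trans.
move: ll'; rewrite -l0 le_eqVlt => /predU1P[<-//|l'0].
rewrite level_gt0// level_0 => x /= l'x.
by apply: subset_closure => /=; exact: lt_le_trans l'x.
Qed.

Lemma fuzzy_quasiconcave u x y z : x <= z <= y -> Num.min (u x) (u y) <= u z.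
Proof.
move=> /andP[xz zy]; have [_ _ _ conv _] := membershipP u.
have [xy|yx] := ltP x y; last first.
  have <- : x = z by apply/le_anti; rewrite xz (le_trans zy).
  by rewrite ge_min lexx.
have yx0 : y - x != 0 by rewrite subr_eq0 gt_eqF.
have yxp : 0 < y - x by rewrite subr_gt0.
have -> : z = (y - z) / (y - x) * x + (1 - (y - z) / (y - x)) * y by field.
apply: conv; rewrite ler_pdivrMr// mul1r lerB// andbT.
by rewrite divr_ge0// subr_ge0// ltW.
Qed.

(** For the level 0, which is a closure, convexity is obtained through
    connectedness. *)
Lemma is_interval_level u l : 0 <= l -> is_interval (level u l).
Proof.
rewrite le_eqVlt => /predU1P[<-|l0].
  rewrite level_0; apply/connected_intervalP/connected_closure.
  apply/connected_intervalP => x y /= ux uy z /(fuzzy_quasiconcave u).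
  by apply: lt_le_trans; rewrite lt_min ux.
rewrite level_gt0// => x y /= ux uy z /(fuzzy_quasiconcave u).
by apply: le_trans; rewrite le_min ux.
Qed.

Lemma level_sum n (c : nat -> R) (u : nat -> fuzzy_number R) l x :
    0 <= l <= 1 ->
  level (\sum_(k < n) fuzzy_scale (c k) (u k)) l x <->
  exists2 y : nat -> R,
    (forall k, level (u k) l (y k)) & x = \sum_(k < n) c k * y k.
Proof.
move=> l01; elim: n x => [|n IH] x.
  rewrite big_ord0 -[X in level X]/(fuzzy_zero R) level_fuzzy_zero//.
  split=> [->|[y _ ->]]; last by rewrite big_ord0.
  have /choice[y uy] : forall k, exists y, level (u k) l y.
    by move=> k; exact: level_neq0.
  by exists y; rewrite ?big_ord0.
rewrite big_ord_recr/= -[X in level X]/(fuzzy_add _ _) level_fuzzy_add//.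
split=> [[s /IH[y uy ->] [t + <-]]|[y uy ->]].
  rewrite level_fuzzy_scale// => -[z uz <-].
  exists (fun k => if k == n then z else y k) => [k|].
    by case: eqP => [->|].
  rewrite big_ord_recr/= eqxx; congr (_ + _).
  by apply: eq_bigr => k _; rewrite ltn_eqF.
exists (\sum_(k < n) c k * y k); first by apply/IH; exists y.
exists (c n * y n); last by rewrite big_ord_recr.
by rewrite level_fuzzy_scale//; exists (y n).
Qed.

End levels.

(** * The sup-norm sendograph distance, level by level *)

Section closeness.
Variable R : realType.
Implicit Types (u v w : fuzzy_number R) (l r : R).

(** For 0 <= r this is: the excess of the sendograph of u over that of w,
    measured with the sup norm of the plane, is at most r.  The point of the
    sendograph of w chosen near (x, l) can be put at the lowest admissible
    height, max (l - r) 0, because levels decrease with the height. *)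
Definition sendograph_near r u w := forall l, 0 <= l <= 1 ->
  forall x, level u l x ->
  exists2 y, level w (Num.max (l - r) 0) y & `|x - y| <= r.

Definition sendograph_close r u w :=
  sendograph_near r u w /\ sendograph_near r w u.

Lemma lowered_level_bounds r l : 0 <= r -> 0 <= l <= 1 ->
  0 <= Num.max (l - r) 0 <= 1.
Proof. by move=> r0 l01; rewrite /Num.max; case: ltP; lra. Qed.

Lemma sendographE u x l : 0 <= l <= 1 -> sendograph u (x, l) <-> level u l x.
Proof.
move=> l01; split=> [[/= ux _ lux]|ux].
  have [l0|l0] := ltP 0 l; first by rewrite level_gt0.
  by rewrite (_ : l = 0)//; apply/le_anti; rewrite l0; case/andP: l01.
split=> //=; first by apply: level_antitone ux; rewrite lexx; case/andP: l01.
have [l0|l0] := ltP 0 l; first by move: ux; rewrite level_gt0.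
by rewrite (le_trans l0)// fuzzy_ge0.
Qed.

(** The Euclidean norm dominates the sup norm; since the bound is strict, the
    infima in the Hausdorff distance yield actual nearby points. *)
Lemma sendograph_close_of_D_S r u w :
  (D_S u w < r%:E)%E -> sendograph_close r u w.
Proof.
rewrite /D_S /hausdorff_dist gt_max => /andP[uw wu].
suff near v v' : (ereal_sup
    [set ereal_inf [set (euclidean_dist p q)%:E | q in sendograph v']
       | p in sendograph v] < r%:E)%E -> sendograph_near r v v'.
  by split; exact: near.
move=> vv' l l01 x vx.
have : (ereal_inf
    [set (euclidean_dist (x, l) q)%:E | q in sendograph v'] < r%:E)%E.
  by apply: le_lt_trans vv'; apply: ereal_sup_ubound; exists (x, l) => //;
     exact/sendographE.
move=> /ereal_inf_lt[_ [[y l'] v'y <-]]; rewrite lte_fin => dr.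
have [_ /= l'01 _] := v'y.
have r0 : 0 <= r by rewrite (le_trans _ (ltW dr))// sqrtr_ge0.
have bound t : t ^+ 2 <= (x - y) ^+ 2 + (l - l') ^+ 2 -> `|t| <= r.
  move=> ht; rewrite (le_trans _ (ltW dr))// -sqrtr_sqr.
  by rewrite /euclidean_dist /= ler_wsqrtr.
exists y; last by apply: bound; rewrite lerDl sqr_ge0.
apply: (level_antitone _ _ _ l'); last exact/sendographE.
have : `|l - l'| <= r by apply: bound; rewrite lerDr sqr_ge0.
rewrite ler_norml => /andP[_ ll']; rewrite le_max lexx orbT/= ge_max.
by apply/andP; split; lra.
Qed.

Lemma euclidean_dist_le (p q : R * R) r : 0 <= r ->
  `|p.1 - q.1| <= r -> `|p.2 - q.2| <= r ->
  euclidean_dist p q <= Num.sqrt 2 * r.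
Proof.
move=> r0 h1 h2; rewrite -[X in _ * X](ger0_norm r0) -sqrtr_sqr -sqrtrM//.
apply: ler_wsqrtr; rewrite mulr_natl mulr2n lerD//.
  by rewrite -[leLHS]real_normK ?num_real// lerXn2r.
by rewrite -[leLHS]real_normK ?num_real// lerXn2r.
Qed.

Lemma D_S_le_of_close r u w : 0 <= r -> sendograph_close r u w ->
  (D_S u w <= (Num.sqrt 2 * r)%:E)%E.
Proof.
move=> r0 [uw wu]; rewrite /D_S /hausdorff_dist ge_max.
suff near v v' : sendograph_near r v v' -> (ereal_sup
    [set ereal_inf [set (euclidean_dist p q)%:E | q in sendograph v']
       | p in sendograph v] <= (Num.sqrt 2 * r)%:E)%E.
  by rewrite !near.
move=> vv'; apply: ge_ereal_sup => _ [[x l] + <-] => /[dup] -[_ /= l01 _].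
move=> /(sendographE _ _ _ l01)/(vv' _ l01)[y v'y xy].
apply: ereal_inf_le; exists (euclidean_dist (x, l) (y, Num.max (l - r) 0))%:E.
  exists (y, Num.max (l - r) 0) => //.
  by apply/sendographE => //; exact: lowered_level_bounds.
rewrite lee_fin euclidean_dist_le//= ler_norml /Num.max.
by case: ltP; lra.
Qed.

(** Closeness compares one level at a time and levels add up by Minkowski sums,
    so nearby points are found summand by summand.  From the combination to w,
    the nearby points all lie in one level of w, which is an interval, so their
    combination stays in it; from w to the combination, the point x of w is
    approximated in each u k separately, and x is the convex combination of
    copies of itself. *)
Lemma sendograph_close_convex r n (c : nat -> R) (u : nat -> fuzzy_number R) w :
  0 <= r -> (forall k, (k < n)%N -> 0 <= c k) -> \sum_(k < n) c k = 1 ->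
  (forall k, (k < n)%N -> c k != 0 -> sendograph_close r (u k) w) ->
  sendograph_close r (\sum_(k < n) fuzzy_scale (c k) (u k)) w.
Proof.
move=> r0 c0 c1 uw; split=> l l01 x;
  have s01 := lowered_level_bounds _ _ r0 l01.
  move=> /(level_sum _ _ _ _ _ _ l01)[y uy ->].
  have [|k kn ck|z wz yz] := convex_sum_approx _ n c y r
    (fun=> level w (Num.max (l - r) 0)) c0 c1.
  - by move=> _; exact: level_neq0.
  - exact: (uw k kn ck).1.
  - exists (\sum_(k < n) c k * z k) => //.
    apply: is_interval_convex_sum => //.
    by apply: is_interval_level; case/andP: s01.
move=> wx.
have [|k kn ck|y uy xy] := convex_sum_approx _ n c (fun=> x) r
  (fun k => level (u k) (Num.max (l - r) 0)) c0 c1.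
- by move=> k; exact: level_neq0.
- exact: (uw k kn ck).2.
- exists (\sum_(k < n) c k * y k); first by apply/level_sum => //; exists y.
  by move: xy; rewrite -mulr_suml c1 mul1r.
Qed.

Lemma D_S_ge0 u w : (0 <= D_S u w)%E.
Proof.
rewrite /D_S /hausdorff_dist le_max; apply/orP; left.
have l01 : 0 <= (0 : R) <= 1 by rewrite lexx ler01.
have [x ux] := level_neq0 u l01.
apply: (@le_trans _ _
  (ereal_inf [set (euclidean_dist (x, 0) q)%:E | q in sendograph w])).
  by apply: le_ereal_inf_tmp => _ [q _ <-]; rewrite lee_fin sqrtr_ge0.
by apply: ereal_sup_ubound; exists (x, 0) => //; exact/sendographE.
Qed.

End closeness.

(** * The weights of the operator *)

Section weights.
Variables (R : realType) (m : R) (sigma : R -> R).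
Hypotheses (m_gt0 : 0 < m) (sigmaA : class_A m sigma).

Lemma sigma_bump_ge0 x : 0 <= sigma_bump m sigma x.
Proof.
have [mono _ _] := sigmaA.
by rewrite /sigma_bump subr_ge0 mono//; have := m_gt0; lra.
Qed.

Lemma sigma_bump_eq0 x : 2 * m <= `|x| -> sigma_bump m sigma x = 0.
Proof.
have [_ s0 s1] := sigmaA; rewrite /sigma_bump ler_normr => /orP[]xm.
  by rewrite !s1 ?subrr//; have := m_gt0; lra.
by rewrite !s0 ?subrr//; have := m_gt0; lra.
Qed.

(** With t = (x - a) / h these are the weights of the operator: consecutive
    indices differ by 2m in the argument, so the sum telescopes to the
    difference of sigma at a point at or above m and sigma at a point at or
    below -m, that is, to 1 - 0. *)
Lemma sum_sigma_bump (t : R) n : 0 <= t <= n%:R ->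
  \sum_(k < n.+1) sigma_bump m sigma (2 * m * (t - k%:R)) = 1.
Proof.
move=> /andP[t0 tn]; have [_ s0 s1] := sigmaA.
rewrite -(big_mkord xpredT (fun k => sigma_bump m sigma (2 * m * (t - k%:R)))).
rewrite (telescope_sumr_eq (fun k => - sigma (2 * m * (t - k%:R) + m)))//.
  rewrite opprK subr0 s0 ?s1 ?oppr0 ?add0r//.
    by rewrite lerDr; apply: mulr_ge0 => //; have := m_gt0; lra.
  rewrite -[n.+1]addn1 natrD.
  have : m * (t - n%:R) <= 0 by rewrite pmulr_rle0// subr_le0.
  lra.
move=> k _; rewrite /sigma_bump opprK addrC; congr (- sigma _ + _).
by rewrite -addn1 natrD; ring.
Qed.

End weights.

(** * The estimate *)

(** Stated for r strictly above the modulus so that the strict hypothesis of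
    [sendograph_close_of_D_S] is available at the nodes. *)
Lemma D_S_fuzzy_operator_le (R : realType) (a b m : R) (sigma : R -> R)
    (f : R -> fuzzy_number R) (n : nat) (x r : R) :
  a < b -> 0 < m -> class_A m sigma -> (1 <= n)%N -> x \in `[a, b] ->
  (fuzzy_modulus a b f ((b - a) / n%:R) < r%:E)%E ->
  (D_S (fuzzy_operator a b m sigma n f x) (f x) <= (Num.sqrt 2 * r)%:E)%E.
Proof.
move=> ab m0 sA n0 xab; rewrite /fuzzy_operator /=.
have n0R : (0 : R) < n%:R by rewrite ltr0n.
set h := (b - a) / n%:R => omega_r.
have h0 : 0 < h by rewrite divr_gt0// subr_gt0.
have hn : b = a + n%:R * h by rewrite /h; field; rewrite gt_eqF.
have close y : y \in `[a, b] -> `|y - x| < h -> (D_S (f y) (f x) < r%:E)%E.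
  move=> yab yx; apply: le_lt_trans omega_r; apply: ereal_sup_ubound.
  by exists (y, x).
have r0 : 0 <= r.
  rewrite -lee_fin; apply: le_trans (ltW (close x xab _)); first exact: D_S_ge0.
  by rewrite subrr normr0.
have argE k : 2 * m / h * (x - (a + k%:R * h)) = 2 * m * ((x - a) / h - k%:R).
  by field; rewrite gt_eqF.
apply: D_S_le_of_close => //.
apply: (sendograph_close_convex _ _ _
  (fun k : nat => sigma_bump m sigma (2 * m / h * (x - (a + k%:R * h))))
  (fun k : nat => f (a + k%:R * h))) => //.
- by move=> k _; exact: sigma_bump_ge0.
- under eq_bigr do rewrite argE.
  apply: sum_sigma_bump => //; move: xab; rewrite in_itv/= {1}hn => /andP[ax xb].
  by rewrite ler_pdivrMr// lerBlDl xb andbT divr_ge0 ?subr_ge0// ltW.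
- move=> k kn ck; apply: sendograph_close_of_D_S; apply: close.
    rewrite in_itv/= hn; apply/andP; split.
      by rewrite lerDl mulr_ge0// ltW.
    by rewrite lerD2l ler_wpM2r ?ler_nat// ltW.
  rewrite ltNge; apply: contra_neqN ck; rewrite distrC => hk; apply: sigma_bump_eq0 => //.
  rewrite normrM ger0_norm; last by rewrite divr_ge0// ltW// mulr_gt0.
  by rewrite mulrAC ler_pdivlMr// ler_wpM2l// mulr_ge0// ltW.
Qed.

Theorem theorem4p2 (R : realType) (a b : R) (hab : a < b) (m : R) (hm : 0 < m)
    (sigma : R -> R) (hsigma : class_A m sigma)
    (f0 : R -> fuzzy_number R) (hf0 : D_S_continuous a b f0)
    (n : nat) (hn : (1 <= n)%N) :
  (ereal_sup [set D_S (fuzzy_operator a b m sigma n f0 x) (f0 x)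
               | x in [set` `[a, b]]]
   <= (Num.sqrt 2)%:E * fuzzy_modulus a b f0 ((b - a) / n%:R))%E.
Proof.
apply: ge_ereal_sup => _ [x xab <-].
have bound r := D_S_fuzzy_operator_le R a b m sigma f0 n x r hab hm hsigma hn xab.
have s0 : (0 : R) < Num.sqrt 2 by rewrite sqrtr_gt0.
have : (0 <= fuzzy_modulus a b f0 ((b - a) / n%:R))%E.
  apply: (le_trans (D_S_ge0 _ (f0 x) (f0 x))).
  apply: ereal_sup_ubound; exists (x, x) => //; split=> //=.
  by rewrite subrr normr0 divr_gt0 ?subr_gt0// ltr0n.
case: fuzzy_modulus bound => [d bound _|_ _|//]; last first.
  by rewrite gt0_muley ?lte_fin// leey.
apply/lee_addgt0Pr => e e0; rewrite -EFinM -EFinD.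
have -> : Num.sqrt 2 * d + e = Num.sqrt 2 * (d + e / Num.sqrt 2).
  by field; rewrite gt_eqF.
by apply: bound; rewrite lte_fin ltrDl divr_gt0.
Qed.
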